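(* Fix $\gamma\ge0$ and $\theta\in(0,\tfrac23)$, and consider the shifted form of drifting game V2 with $N$ chips and $T$ rounds, where $\delta\in[0,1]$ is determined by $\gamma=\delta^2T/2$. Let $\tau=T^\theta$. Suppose that in each round $t$ the player uses the following distribution: if at least one chip has $s_{t,i}>-\delta T$, then $p_{t,i}$ is proportional to $$\begin{cases}0,& s_{t,i}\le-\delta T,\\ -f'(s_{t,i},t+1-\tau),& s_{t,i}>-\delta T;\end{cases}$$ if all chips have $s_{t,i}\le-\delta T$, then $\mathbf p_t$ is an arbitrary probability vector. Then for any adversary strategy, $$\frac1N\sum_{i=1}^N L(s_{0,i})\le\frac{2}{\sqrt\pi}\int_{\sqrt\gamma}^\infty e^{-x^2}\,dx+O(T^{-\theta/2}),$$ where $O(\cdot)$ is understood as $T\to\infty$ with an implied constant depending only on $\gamma$ and $\theta$.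
   Context: Shifted form of drifting game V2. There are $N$ chips with positions $s_{t,i}$, and rounds $t=-T,-T+1,\dots,-1$; initially $s_{-T,i}=0$ for all $i$. In round $t$ the player announces a probability vector $\mathbf p_t=(p_{t,1},\dots,p_{t,N})$; then the adversary, knowing $\mathbf p_t$, chooses $\mathbf z_t=(z_{t,1},\dots,z_{t,N})$ with $z_{t,i}\in[-1-\delta,1-\delta]$ for all $i$ and $\sum_ip_{t,i}z_{t,i}\ge0$; the positions are updated by $s_{t+1,i}=s_{t,i}+z_{t,i}$. The player's final loss is $\frac1N\sum_{i=1}^NL(s_{0,i})$ with $L(s)=\mathbf 1_{\{s\le-\delta T\}}$. (This is equivalent, via $z_i\mapsto z_i-\delta$, to the game with moves in $[-1,1]$, constraint $\mathbf p\cdot\mathbf z\ge\delta$ and loss $\mathbf 1_{\{s\le0\}}$.) An adversary strategy chooses an admissible $\mathbf z_t$ from the history of play and $\mathbf p_t$. For $t<0$ the function $f$ is $$f(s,t)=\begin{cases}\frac{2}{\sqrt\pi}\int_{(s+\delta T)/\sqrt{-2t}}^\infty e^{-x^2}\,dx,& s>-\delta T,\\ 1,& s\le-\delta T,\end{cases}$$ and $f'$ denotes its derivative in $s$ (used only for $s>-\delta T$). *)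

(* Defs.v *)
From mathcomp Require Export all_boot all_order all_algebra.
From mathcomp Require Export all_classical all_reals all_analysis.
Export Order.TTheory GRing.Theory Num.Theory.
Export numFieldNormedType.Exports.

Set Implicit Arguments.
Unset Strict Implicit.
Unset Printing Implicit Defensive.

Local Open Scope classical_set_scope.
Local Open Scope ring_scope.

Definition gauss_tail (R : realType) (a : R) : R :=
  2 / Num.sqrt pi *
    \int[@lebesgue_measure R]_(x in `[a, +oo[) expR (- x ^+ 2).

(* The time [t] is real because [potential] is also evaluated at the shifted,
   generally non-integer times [t + 1 - tau]; only [t < 0] is meaningful. *)
Definition potential (R : realType) (delta : R) (T : nat) (s t : R) : R :=
  if s <= - (delta * T%:R) then 1
  else gauss_tail ((s + delta * T%:R) / Num.sqrt (- 2 * t)).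

Definition potential' (R : realType) (delta : R) (T : nat) (s t : R) : R :=
  derive1 (fun u : R => potential delta T u t) s.

(* The pairs (p_t, z_t) of the rounds already played, latest round first. *)
Definition history (R : realType) (N : nat) : Type :=
  seq (('I_N -> R) * ('I_N -> R)).

Fixpoint position (R : realType) (N : nat) (h : history R N) (i : 'I_N) : R :=
  if h is m :: h' then position h' i + m.2 i else 0.

(* After [k] rounds the index of the round about to be played is [- T + k]. *)
Definition time (R : realType) (N : nat) (T : nat) (h : history R N) : R :=
  - T%:R + (size h)%:R.

Definition player_strategy (R : realType) (N : nat) : Type :=
  history R N -> 'I_N -> R.

Definition adversary_strategy (R : realType) (N : nat) : Type :=
  history R N -> ('I_N -> R) -> 'I_N -> R.

Fixpoint play (R : realType) (N : nat) (player : player_strategy R N)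
    (adversary : adversary_strategy R N) (k : nat) : history R N :=
  if k is k'.+1 then
    let h := play player adversary k' in
    (player h, adversary h (player h)) :: h
  else [::].

Definition prob_vector (R : realType) (N : nat) (p : 'I_N -> R) : Prop :=
  (forall i, 0 <= p i) /\ \sum_(i < N) p i = 1.

Definition admissible_move (R : realType) (N : nat) (delta : R)
    (p z : 'I_N -> R) : Prop :=
  (forall i, -1 - delta <= z i <= 1 - delta) /\
  0 <= \sum_(i < N) p i * z i.

Definition admissible_adversary (R : realType) (N : nat) (delta : R) (T : nat)
    (adversary : adversary_strategy R N) : Prop :=
  forall (h : history R N) (p : 'I_N -> R),
    (size h < T)%N -> prob_vector p -> admissible_move delta p (adversary h p).

Definition weight (R : realType) (N : nat) (delta : R) (T : nat) (tau : R)
    (h : history R N) (i : 'I_N) : R :=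
  if position h i <= - (delta * T%:R) then 0
  else - potential' delta T (position h i) (time T h + 1 - tau).

Definition prescribed (R : realType) (N : nat) (delta : R) (T : nat) (tau : R)
    (h : history R N) (p : 'I_N -> R) : Prop :=
  prob_vector p /\
  ((exists i, - (delta * T%:R) < position h i) ->
   exists c : R, forall i, p i = c * weight delta T tau h i).

Definition loss (R : realType) (delta : R) (T : nat) (s : R) : R :=
  (s <= - (delta * T%:R))%R%:R.

Definition final_loss (R : realType) (N : nat) (delta : R) (T : nat)
    (player : player_strategy R N) (adversary : adversary_strategy R N) : R :=
  N%:R^-1 * \sum_(i < N) loss delta T (position (play player adversary T) i).

(* Main.v *)
Require Import Defs.
From mathcomp Require Import ring lra.

(* In the variable u = s + delta T the potential is the error-function profile
   E(u / sqrt(-2t)) with E = gauss_tail, which solves the backward heat equation.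
   Hence in one round, with r = -t, the change of the potential of an alive chip
   moving by z is f' z plus an error O(r^(-3/2)): the cubic Taylor remainder, the
   quartic remainder of the time shift, and f'' (z^2 - 1) = O(delta / r), where
   delta = O(T^(-1/2)) = O(r^(-1/2)). Truncating E at 1 below u = 0 can only
   decrease the potential after the move, and dead chips are at its maximum 1.
   The prescribed weights make the sum of the f' z nonpositive, and summing
   r^(-3/2) over r >= tau costs O(tau^(-1/2)). The shift of time by tau costs
   O(tau / T) initially, which is where theta <= 2/3 enters. *)

Set Implicit Arguments.
Unset Strict Implicit.
Unset Printing Implicit Defensive.

Local Open Scope classical_set_scope.
Local Open Scope ring_scope.

(** * Comparison of increments through derivatives *)

Section Comparison.
Variable R : realType.
Implicit Types f g df dg : R -> R.

(** The mean value theorem for [g - f]. Pointwise bounds on the Gaussian density become bounds on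
    the tail by taking a polynomial for one of the two functions. *)
Lemma ler_increment f g df dg (a b : R) : a <= b ->
  (forall x : R, is_derive x 1 f (df x)) ->
  (forall x : R, is_derive x 1 g (dg x)) ->
  (forall x, a <= x <= b -> df x <= dg x) -> f b - f a <= g b - g a.
Proof.
move=> ab fd gd fg.
have gfd (x : R) : is_derive x 1 (g - f) (dg x - df x) by exact: is_deriveB.
have gfc : {within `[a, b], continuous (g - f)}.
  by apply: derivable_within_continuous => x _; have [] := gfd x.
have [y yab E] := MVT_segment ab (fun x _ => gfd x) gfc.
have : 0 <= (dg y - df y) * (b - a) by rewrite mulr_ge0// subr_ge0// fg.
rewrite -E -![(_ - _ : _ -> _) _]/(_ - _); lra.
Qed.

Lemma is_derive_cubic (a b c d x : R) :
  is_derive x 1 (fun w : R => a + b * w + c * w ^+ 2 + d * w ^+ 3)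
    (b + 2 * c * x + 3 * d * x ^+ 2).
Proof.
by apply: is_derive_eq; rewrite /GRing.scale/=; ring.
Qed.

End Comparison.

(** * The Gaussian tail: derivative, monotonicity, convexity *)

Section GaussTail.
Variable R : realType.
Let mu := @lebesgue_measure R.

Lemma gauss_coef_gt0 : 0 < 2 / Num.sqrt pi :> R.
Proof. by rewrite divr_gt0// sqrtr_gt0 pi_gt0. Qed.

Lemma gauss_tail0 : gauss_tail 0 = 1 :> R.
Proof.
rewrite /gauss_tail /Rintegral.
have -> := @integral0y_gauss R.
by rewrite /= mulrA divfK ?divff// gt_eqF// sqrtr_gt0 pi_gt0.
Qed.

Lemma gauss_tail_ge0 (a : R) : 0 <= gauss_tail a.
Proof.
rewrite mulr_ge0 ?(ltW gauss_coef_gt0)//.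
by apply: Rintegral_ge0 => //= x _; exact: expR_ge0.
Qed.

Lemma is_derive_gauss_tail (x : R) :
  is_derive x 1 (@gauss_tail R) (- (2 / Num.sqrt pi * expR (- x ^+ 2))).
Proof.
pose F y := \int[mu]_(t in `]-oo, y]) gauss_fun t.
(* The fundamental theorem of calculus concerns a moving upper limit, so the tail is rewritten as
   the full integral minus the integral up to [y]. *)
have -> : @gauss_tail R =
    (fun y => 2 / Num.sqrt pi * (\int[mu]_(t in setT) gauss_fun t - F y)).
  apply/funext => y; rewrite /gauss_tail /F; congr (_ * _).
  rewrite -set_itvNyy Rintegral_itvB//.
  - rewrite Rintegral_itv_obnd_cbnd//.
    by apply: integrableS (@integrableT_gauss R).
  - by apply: integrableS (@integrableT_gauss R).
have [dF F'] : derivable F x 1 /\ derive1 F x = gauss_fun x.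
  apply: (@continuous_FTC1 R _ -oo%O x (x + 1)); rewrite ?ltrDl//.
  - by apply: integrableS (@integrableT_gauss R).
  - exact: ltNyr.
  - exact: continuous_gauss_fun.
have iF : is_derive x 1 F (gauss_fun x).
  by apply: DeriveDef; [exact: dF|rewrite -derive1E].
apply: is_derive_eq; rewrite /GRing.scale/= /gauss_fun; ring.
Qed.

Lemma gauss_le1 (x : R) : expR (- x ^+ 2) <= 1.
Proof. exact: gauss_fun_le1. Qed.

(** Factor out [expR (- x ^+ 2)] and use exp(v) >= 1 + v at v = x^2 - y^2. *)
Lemma gauss_ge_tangent (x y : R) :
  expR (- x ^+ 2) * (1 + x ^+ 2 - y ^+ 2) <= expR (- y ^+ 2).
Proof.
rewrite [leRHS](_ : _ = expR (- x ^+ 2 + (x ^+ 2 - y ^+ 2))); last first.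
  by congr expR; ring.
by rewrite expRD ler_wpM2l ?expR_ge0// -addrA; exact: expR_ge1Dx.
Qed.

Lemma sqr_gauss_le1 (x : R) : x ^+ 2 * expR (- x ^+ 2) <= 1.
Proof.
have := gauss_ge_tangent x 0; rewrite expr0n/= oppr0 expR0 addr0.
have := expR_ge0 (- x ^+ 2); lra.
Qed.

Lemma norm_gauss_le1 (x : R) : `|x| * expR (- x ^+ 2) <= 1.
Proof.
have := sqr_gauss_le1 x; have := gauss_le1 x; have := expR_ge0 (- x ^+ 2).
rewrite -(real_normK (num_real x)) => q0 q1 q2.
have : 0 <= (1 - `|x|) ^+ 2 * expR (- `|x| ^+ 2) by rewrite mulr_ge0 ?sqr_ge0.
lra.
Qed.

Lemma gauss_tail_nincr (a b : R) : a <= b -> gauss_tail b <= gauss_tail a.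
Proof.
move=> ab; rewrite -subr_le0.
have -> : 0 = cst (0 : R) b - cst 0 a :> R by rewrite subrr.
apply: (ler_increment ab is_derive_gauss_tail (fun x => is_derive_cst _ _ _)).
by move=> x _ /=; rewrite oppr_le0 mulr_ge0 ?expR_ge0// ltW// gauss_coef_gt0.
Qed.

Lemma gauss_tail_le1 (a : R) : 0 <= a -> gauss_tail a <= 1.
Proof. by move=> a0; rewrite -gauss_tail0 gauss_tail_nincr. Qed.

Lemma gauss_tail_lipschitz (y x : R) : y <= x ->
  gauss_tail y <= gauss_tail x + 2 / Num.sqrt pi * (x - y).
Proof.
move=> yx.
have := ler_increment yx
  (fun z => @is_derive_cubic _ 0 (- (2 / Num.sqrt pi)) 0 0 z)
  is_derive_gauss_tail.
have c0 := gauss_coef_gt0; move: (2 / _) c0 => d d0 /(_ _)/wrap[].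
  move=> z _; rewrite !(mulr0, mul0r, addr0) lerN2.
  by rewrite ler_piMr ?gauss_le1// ltW.
lra.
Qed.

(** On the nonnegative half-line the density decreases, so over [y, x] it is at least its value at
    [x]. *)
Lemma gauss_tail_convex (y x : R) : 0 <= y <= x ->
  gauss_tail x + 2 / Num.sqrt pi * expR (- x ^+ 2) * (x - y) <= gauss_tail y.
Proof.
move=> /andP[y0 yx].
have := ler_increment yx is_derive_gauss_tail
  (fun z => @is_derive_cubic _ 0 (- (2 / Num.sqrt pi * expR (- x ^+ 2))) 0 0 z).
have c0 := gauss_coef_gt0; move: (2 / _) c0 => d d0 /(_ _)/wrap[].
  move=> z /andP[yz zx]; rewrite !(mulr0, mul0r, addr0) lerN2.
  rewrite ler_wpM2l ?(ltW d0)// ler_expR lerN2 lerXn2r// nnegrE; lra.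
lra.
Qed.

(** * Taylor and time-shift estimates, and the change of the tail in one round *)

Lemma is_derive_gauss_tail_shift (x w : R) :
  is_derive w 1 (fun v => gauss_tail (x + v))
    (- (2 / Num.sqrt pi * expR (- (x + w) ^+ 2))).
Proof.
rewrite -[X in is_derive _ _ _ X]mulr1.
apply: (@is_derive1_comp R (@gauss_tail R) (fun v => x + v)).
  exact: is_derive_gauss_tail.
by apply: is_derive_eq; ring.
Qed.

Lemma is_derive_gauss_tail_opp_shift (x w : R) :
  is_derive w 1 (fun v => gauss_tail (x - v))
    (2 / Num.sqrt pi * expR (- (x - w) ^+ 2)).
Proof.
rewrite -[X in is_derive _ _ _ X]opprK.
rewrite -[X in is_derive _ _ _ (- X)]mulr1 -mulrN.
apply: (@is_derive1_comp R (@gauss_tail R) (fun v => x - v)).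
  exact: is_derive_gauss_tail.
by apply: is_derive_eq; ring.
Qed.

(** The tangent bound based at y = x - v is multiplied by 1 + 2xv; the terms of first order in [v]
    cancel. With Q, yQ and y^2 Q at most 1 and v <= 2, the rest is at most (4 + 6 * 2 + 2 * 4) v^2 =
    24 v^2. *)
Lemma gauss_backward_le (x v : R) : 0 <= x -> 0 <= v <= 2 ->
  expR (- (x - v) ^+ 2) <= expR (- x ^+ 2) * (1 + 2 * x * v) + 24 * v ^+ 2.
Proof.
move=> x0 /andP[v0 v2].
have := gauss_ge_tangent (x - v) x.
have := sqr_gauss_le1 (x - v); have := norm_gauss_le1 (x - v).
have := gauss_le1 (x - v); have := expR_ge0 (- (x - v) ^+ 2).
move: (expR (- (x - v) ^+ 2)) (expR (- x ^+ 2)) => Q P Q0 Q1 Q2 Q3 QP.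
set y := x - v in Q0 Q1 Q2 Q3 QP *.
have xE : x = y + v by rewrite /y subrK.
have xv0 : 0 <= x * v by rewrite mulr_ge0.
apply: (@le_trans _ _
  (Q * (1 + y ^+ 2 - x ^+ 2) * (1 + 2 * x * v) + 24 * v ^+ 2)).
  rewrite xE.
  have -> : Q * (1 + y ^+ 2 - (y + v) ^+ 2) * (1 + 2 * (y + v) * v) =
    Q - v ^+ 2 * (4 * (y ^+ 2 * Q) - Q + 6 * v * (y * Q) + 2 * v ^+ 2 * Q).
    by ring.
  rewrite -subr_ge0 (_ : _ - _ = v ^+ 2 * (24 - (4 * (y ^+ 2 * Q) - Q +
    6 * v * (y * Q) + 2 * v ^+ 2 * Q))); last by ring.
  rewrite mulr_ge0 ?sqr_ge0//.
  have yQ : y * Q <= 1.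
    by apply: le_trans Q2; rewrite ler_wpM2r// ler_norm.
  have : v * (y * Q) <= 2 by nra.
  have : v ^+ 2 * Q <= 4 by nra.
  lra.
rewrite lerD2r ler_wpM2r//; lra.
Qed.

(** Each sign of [w] integrates a linearized density bound with error at most 24 v^2, whence the
    cubic coefficient 8 = 24 / 3: [gauss_ge_tangent] to the right, [gauss_backward_le] to the
    left. *)
Lemma gauss_tail_taylor (x w : R) : 0 <= x -> `|w| <= 2 ->
  gauss_tail (x + w) <= gauss_tail x - 2 / Num.sqrt pi * expR (- x ^+ 2) * w
    + 2 / Num.sqrt pi * (x * expR (- x ^+ 2)) * w ^+ 2
    + 8 * (2 / Num.sqrt pi) * `|w| ^+ 3.
Proof.
move=> x0; have d0 := gauss_coef_gt0; have q0 := expR_ge0 (- x ^+ 2).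
have q1 := gauss_le1 x.
have [w0 w2|w0 w2] := ger0P w.
  set d := 2 / Num.sqrt pi in d0 *.
  have := ler_increment w0 (is_derive_gauss_tail_shift x)
    (is_derive_cubic 0 (- (d * expR (- x ^+ 2))) (d * (x * expR (- x ^+ 2)))
       (8 * d)).
  move=> /(_ _)/wrap[].
    move=> v /andP[v0 vw]; rewrite -/d.
    have := gauss_ge_tangent x (x + v).
    move: (expR (- (x + v) ^+ 2)) (expR (- x ^+ 2)) q0 q1 => Q P P0 P1 QP.
    rewrite -subr_ge0.
    rewrite (_ : _ - _ = d * (Q - P * (1 + x ^+ 2 - (x + v) ^+ 2) +
      v ^+ 2 * (24 - P))); last by ring.
    apply: mulr_ge0; first exact: ltW.
    apply: addr_ge0; first by rewrite subr_ge0.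
    apply: mulr_ge0; first exact: sqr_ge0.
    lra.
  rewrite addr0; lra.
set d := 2 / Num.sqrt pi in d0 *.
have vw0 : 0 <= - w by rewrite oppr_ge0 ltW.
have := ler_increment vw0 (is_derive_gauss_tail_opp_shift x)
    (is_derive_cubic 0 (d * expR (- x ^+ 2)) (d * (x * expR (- x ^+ 2)))
       (8 * d)).
move=> /(_ _)/wrap[].
  move=> v /andP[v0 vw]; rewrite -/d.
  have := @gauss_backward_le x v x0; rewrite v0 (le_trans vw w2) => /(_ isT).
  move: (expR (- (x - v) ^+ 2)) (expR (- x ^+ 2)) => Q P QP.
  rewrite -subr_ge0.
  rewrite (_ : _ - _ = d * (P * (1 + 2 * x * v) + 24 * v ^+ 2 - Q));
    last by ring.
  by rewrite mulr_ge0 ?(ltW d0)// subr_ge0.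
rewrite subr0 opprK; lra.
Qed.

(** Moving one unit back in time multiplies the argument by rho = (1 + 2h^2)^(-1/2). By convexity
    the tail gains at least its slope at [x] times x(1 - rho). The leading gain, in h^2, is the one
    that offsets the quadratic Taylor term of a unit move. *)
Lemma gauss_tail_contract (x h rho : R) : 0 <= x -> 0 <= rho ->
  rho ^+ 2 * (1 + 2 * h ^+ 2) = 1 ->
  gauss_tail x + 2 / Num.sqrt pi * (x * expR (- x ^+ 2)) *
    (h ^+ 2 - 3 / 2 * h ^+ 4) <= gauss_tail (x * rho).
Proof.
move=> x0 rho0 rhoE; have d0 := gauss_coef_gt0.
have -> : h ^+ 4 = (h ^+ 2) ^+ 2 by ring.
have := sqr_ge0 h; move: (h ^+ 2) rhoE => k rhoE k0.
have rho1 : rho <= 1.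
  rewrite -(@expr_le1 _ 2)// -rhoE ler_peMr ?sqr_ge0//; lra.
(* The right side is the second-order Taylor polynomial of (1 + 2k)^(-1/2). After squaring and
   clearing 1 + 2k, the difference is k^3 times a quadratic of negative discriminant. *)
have rhom : rho <= 1 - k + 3 / 2 * k ^+ 2.
  rewrite -(@ler_pXn2r _ 2)// ?nnegrE; last by nra.
  rewrite -(@ler_pM2r _ (1 + 2 * k)); last by lra.
  rewrite rhoE -subr_ge0.
  rewrite (_ : _ - _ = k ^+ 3 * (5 - 15 / 4 * k + 9 / 2 * k ^+ 2));
    last by field.
  rewrite mulr_ge0 ?exprn_ge0//; nra.
have xrho : 0 <= x * rho <= x by rewrite mulr_ge0//= ler_piMr.
apply: le_trans (gauss_tail_convex xrho); rewrite lerD2l.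
rewrite -[leRHS]mulrA -[leLHS]mulrA ler_pM2l//.
rewrite -subr_ge0 (_ : _ - _ = x * expR (- x ^+ 2) *
  (1 - k + 3 / 2 * k ^+ 2 - rho)); last by ring.
by rewrite mulr_ge0 ?subr_ge0// mulr_ge0 ?expR_ge0.
Qed.

(** Makes the error of order a^(-3) telescope over the rounds. Since b - a = 2 / (a + b), the claim
    reduces to b(a + b) <= 6a^2, which follows from b <= 2a. *)
Lemma cube_inv_le (a b : R) : 1 <= a -> 0 <= b -> b ^+ 2 = a ^+ 2 + 2 ->
  a^-1 ^+ 3 <= 3 * (a^-1 - b^-1).
Proof.
move=> a1 b0 bE.
have a0 : 0 < a by lra.
have ab : a < b by rewrite -(@ltr_pXn2r _ 2)// ?nnegrE; lra.
have b2a : b <= 2 * a by rewrite -(@ler_pXn2r _ 2)// ?nnegrE; nra.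
have bp : 0 < b by lra.
have -> : a^-1 ^+ 3 = b / (a ^+ 3 * b) by field; rewrite !gt_eqF.
have -> : 3 * (a^-1 - b^-1) = 3 * a ^+ 2 * (b - a) / (a ^+ 3 * b).
  by field; rewrite !gt_eqF.
rewrite ler_pM2r ?invr_gt0 ?mulr_gt0 ?exprn_gt0//.
rewrite -(@ler_pM2r _ (b + a)); last by lra.
have -> : 3 * a ^+ 2 * (b - a) * (b + a) = 3 * a ^+ 2 * (b ^+ 2 - a ^+ 2).
  by ring.
rewrite bE; nra.
Qed.

(* a and b stand for sqrt(-2t) and sqrt(-2(t - 1)). *)
Lemma gauss_tail_step (a b u z delta D : R) :
  1 <= a -> 0 <= b -> b ^+ 2 = a ^+ 2 + 2 -> 0 <= u -> 0 <= delta <= 1 ->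
  delta * a <= D -> -1 - delta <= z <= 1 - delta ->
  gauss_tail ((u + z) / a) <= gauss_tail (u / b)
    - 2 / Num.sqrt pi * expR (- (u / a) ^+ 2) / a * z
    + 3 * (2 / Num.sqrt pi) * (66 + 3 * D) * (a^-1 - b^-1).
Proof.
move=> a1 b0 bE u0 /andP[d0 d1] dD /andP[z0 z1].
have a0 : 0 < a by lra.
have bp : 0 < b by rewrite lt_neqAle b0 andbT eq_sym -sqrf_eq0 bE gt_eqF//; nra.
have k0 := gauss_coef_gt0; have h3 := cube_inv_le a1 b0 bE.
set k := 2 / Num.sqrt pi in k0 *; set h := a^-1 in h3 *.
have h0 : 0 < h by rewrite invr_gt0.
have h1 : h <= 1 by rewrite invf_le1.
have dDh : delta <= D * h by rewrite ler_pdivlMr.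
have D0 : 0 <= D by nra.
have x0 : 0 <= u * h by rewrite mulr_ge0// ltW.
have zn : `|z| <= 1 + delta by rewrite ler_norml; apply/andP; split; lra.
have w2 : `|z * h| <= 2 * h.
  by rewrite normrM (gtr0_norm h0) ler_wpM2r ?(ltW h0)//; lra.
have w2' : `|z * h| <= 2 by nra.
have T := gauss_tail_taylor x0 w2'; rewrite -/k in T.
have rhoE : (a / b) ^+ 2 * (1 + 2 * h ^+ 2) = 1.
  have -> : (a / b) ^+ 2 * (1 + 2 * h ^+ 2) = (a ^+ 2 + 2) / b ^+ 2.
    by rewrite /h; field; rewrite !gt_eqF.
  by rewrite -bE divff// expf_neq0// gt_eqF.
have S := gauss_tail_contract x0 (ltW (divr_gt0 a0 bp)) rhoE; rewrite -/k in S.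
have Eb : u * h * (a / b) = u / b by rewrite /h; field; rewrite !gt_eqF.
rewrite Eb in S; rewrite mulrDl.
have X0 : 0 <= u * h * expR (- (u * h) ^+ 2) by rewrite mulr_ge0 ?expR_ge0.
have X1 : u * h * expR (- (u * h) ^+ 2) <= 1.
  by have := norm_gauss_le1 (u * h); rewrite (ger0_norm x0).
have w3 : `|z * h| ^+ 3 <= 8 * h ^+ 3.
  have -> : 8 * h ^+ 3 = (2 * h) ^+ 3 by ring.
  by rewrite lerXn2r// nnegrE// mulr_ge0// ltW.
(* From |z| <= 1 + delta and delta^2 <= delta. *)
have zsq : z ^+ 2 <= 1 + 3 * delta by nra.
have wsq : (z * h) ^+ 2 <= h ^+ 2 + 3 * D * h ^+ 3.
  rewrite exprMn; apply: (@le_trans _ _ ((1 + 3 * (D * h)) * h ^+ 2)).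
    by rewrite ler_wpM2r ?sqr_ge0//; lra.
  by rewrite le_eqVlt; apply/orP; left; apply/eqP; ring.
have h3p : 0 <= h ^+ 3 by rewrite exprn_ge0// ltW.
have h4 : h ^+ 4 <= h ^+ 3 by rewrite exprS ler_piMl.
move: (u * h * expR _) X0 X1 T S => X X0 X1 T S.
(* The heat-equation cancellation: the terms X h^2 on both sides agree, and X <= 1 with h^4 <= h^3
   bounds the remainder. *)
have Q1 : X * (z * h) ^+ 2 <= X * (h ^+ 2 - 3 / 2 * h ^+ 4)
    + (3 * D + 3 / 2) * h ^+ 3.
  apply: (@le_trans _ _ (X * (h ^+ 2 + 3 * D * h ^+ 3))).
    by rewrite ler_wpM2l.
  rewrite -subr_ge0 (_ : _ - _ = 3 * D * h ^+ 3 * (1 - X) +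
    3 / 2 * (h ^+ 3 - h ^+ 4 + (1 - X) * h ^+ 4)); last by field.
  have h4p : 0 <= h ^+ 4 by rewrite exprn_ge0// ltW.
  have X1' : 0 <= 1 - X by rewrite subr_ge0.
  have h34 : 0 <= h ^+ 3 - h ^+ 4 by rewrite subr_ge0.
  have := mulr_ge0 X1' h4p; have := mulr_ge0 (mulr_ge0 D0 h3p) X1'; lra.
(* The cubic remainder contributes 8 * 8 = 64 and the previous bound 3D + 3/2, which together stay
   below 66 + 3D. *)
have Q2 : k * (X * (z * h) ^+ 2 + 8 * `|z * h| ^+ 3) <=
    k * (X * (h ^+ 2 - 3 / 2 * h ^+ 4) + (66 + 3 * D) * (3 * (a^-1 - b^-1))).
  rewrite ler_pM2l//.
  have : (66 + 3 * D) * h ^+ 3 <= (66 + 3 * D) * (3 * (a^-1 - b^-1)).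
    by rewrite ler_wpM2l//; lra.
  lra.
rewrite -/h in Q2; lra.
Qed.

End GaussTail.

(** * The truncated potential and its change for a single chip *)

Section Potential.
Variables (R : realType) (delta : R) (T : nat).
Hypothesis delta01 : 0 <= delta <= 1.
Implicit Types s t z : R.

Lemma potential_dead s t : s <= - (delta * T%:R) -> potential delta T s t = 1.
Proof. by rewrite /potential => ->. Qed.

Lemma potential_alive s t : - (delta * T%:R) < s ->
  potential delta T s t = gauss_tail ((s + delta * T%:R) / Num.sqrt (- 2 * t)).
Proof. by rewrite /potential leNgt => ->. Qed.

Lemma potential_ge0 s t : 0 <= potential delta T s t.
Proof. by rewrite /potential; case: ifP => // _; exact: gauss_tail_ge0. Qed.

Lemma potential_le1 s t : potential delta T s t <= 1.
Proof.
rewrite /potential; case: ifP => // /negbT; rewrite -ltNge => s0.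
by rewrite gauss_tail_le1// divr_ge0// -lerBlDr sub0r ltW.
Qed.

(** A dead chip has a nonpositive argument, where the tail is at least 1. This spares a case
    distinction when a move carries an alive chip across the threshold. *)
Lemma potential_le_gauss_tail s t : potential delta T s t <=
  gauss_tail ((s + delta * T%:R) / Num.sqrt (- 2 * t)).
Proof.
rewrite /potential; case: ifP => // s0.
rewrite -[leLHS]gauss_tail0; apply: gauss_tail_nincr.
by rewrite mulr_le0_ge0 ?invr_ge0// -lerBrDr sub0r.
Qed.

Lemma potential'_alive s t : - (delta * T%:R) < s ->
  potential' delta T s t = - (2 / Num.sqrt pi *
    expR (- ((s + delta * T%:R) / Num.sqrt (- 2 * t)) ^+ 2) /
    Num.sqrt (- 2 * t)).
Proof.
move=> s0; rewrite /potential' derive1E; set r := Num.sqrt (- 2 * t).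
have dg : is_derive s 1 (fun u => gauss_tail ((u + delta * T%:R) / r))
    (- (2 / Num.sqrt pi * expR (- ((s + delta * T%:R) / r) ^+ 2)) * r^-1).
  apply: (@is_derive1_comp R (@gauss_tail R) (fun u => (u + delta * T%:R) / r)).
    exact: is_derive_gauss_tail.
  by apply: is_derive_eq; rewrite /GRing.scale/=; ring.
(* Being alive is an open condition, so near [s] the potential is the smooth tail. *)
have /near_eq_is_derive/(_ dg)[_ ->] : \near s,
    gauss_tail ((s + delta * T%:R) / r) = potential delta T s t.
  by apply: filterS (lt_nbhsr s0) => u u0; rewrite potential_alive.
by rewrite mulNr.
Qed.

(** Here [t] is the shifted time after the move and [t - 1] the one before it. The slope is taken at
    the later time, as in [weight]. *)
Lemma potential_step s t z D : t <= -1 -> delta * Num.sqrt (- 2 * t) <= D ->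
  -1 - delta <= z <= 1 - delta -> - (delta * T%:R) < s ->
  potential delta T (s + z) t <=
    potential delta T s (t - 1) + potential' delta T s t * z +
    3 * (2 / Num.sqrt pi) * (66 + 3 * D) *
      ((Num.sqrt (- 2 * t))^-1 - (Num.sqrt (- 2 * (t - 1)))^-1).
Proof.
move=> t1 dD zd s0.
rewrite potential'_alive// (potential_alive (t - 1) s0).
apply: le_trans (potential_le_gauss_tail _ _) _.
rewrite (addrAC s z) [_ * z]mulNr.
apply: (@gauss_tail_step R _ _ _ _ delta D _ _ _ _ _ _ zd) => //.
- rewrite -[leLHS]sqrtr1; apply: ler_wsqrtr; lra.
- rewrite !sqr_sqrtr; lra.
- by rewrite -lerBlDr sub0r ltW.
Qed.

End Potential.

(** * Evolution of the total potential along a play *)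

Section Game.
Variables (R : realType) (N T : nat) (delta tau : R).
Hypothesis delta01 : 0 <= delta <= 1.
Implicit Types (h : history R N) (p z : 'I_N -> R).

(** The shift by [tau] makes the final evaluation time [- tau] instead of 0, where the profile would
    be singular. *)
Definition total_potential h : R :=
  \sum_(i < N) potential delta T (position h i) (time T h - tau).

Lemma time_cons m h : time T (m :: h) = time T h + 1.
Proof. by rewrite /time /= -natr1 addrA. Qed.

Lemma weight_ge0 h i : 0 <= weight delta T tau h i.
Proof.
rewrite /weight; case: ifP => // /negbT; rewrite -ltNge => /potential'_alive ->.
by rewrite opprK divr_ge0// mulr_ge0 ?expR_ge0// ltW// gauss_coef_gt0.
Qed.

Lemma weighted_move_ge0 h p z : prescribed delta T tau h p ->
  0 <= \sum_(i < N) p i * z i -> 0 <= \sum_(i < N) weight delta T tau h i * z i.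
Proof.
move=> [[_ p1] pw] pz.
have [alive|dead] := pselect (exists i, - (delta * T%:R) < position h i);
  last first.
  rewrite big1// => i _; rewrite /weight ifT ?mul0r// leNgt.
  by apply/negP => ai; apply: dead; exists i.
have [c pE] := pw alive.
have sumE (y : 'I_N -> R) : \sum_(i < N) p i * y i =
    c * \sum_(i < N) weight delta T tau h i * y i.
  by rewrite mulr_sumr; apply: eq_bigr => i _; rewrite pE mulrA.
have c1 : c * \sum_(i < N) weight delta T tau h i = 1.
  by rewrite mulr_sumr -p1; apply: eq_bigr => i _; rewrite pE.
have W0 : 0 <= \sum_(i < N) weight delta T tau h i.
  by apply: sumr_ge0 => i _; exact: weight_ge0.
(* The product of [c] with a nonnegative total weight is 1, so [c] is positive. *)
have c0 : 0 < c by rewrite ltNge; apply/negP => cn; nra.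
by move: pz; rewrite sumE pmulr_rge0.
Qed.

Lemma total_potential_step h p z D : time T h + 1 - tau <= -1 ->
  delta * Num.sqrt (- 2 * (time T h + 1 - tau)) <= D ->
  prescribed delta T tau h p -> admissible_move delta p z ->
  total_potential ((p, z) :: h) <= total_potential h + N%:R *
    (3 * (2 / Num.sqrt pi) * (66 + 3 * D) *
      ((Num.sqrt (- 2 * (time T h + 1 - tau)))^-1
       - (Num.sqrt (- 2 * (time T h - tau)))^-1)).
Proof.
move=> t1 dD pp [zd pz]; have wz := weighted_move_ge0 pp pz.
have tE : time T h - tau = time T h + 1 - tau - 1 by ring.
set K := 3 * _ * _ * _.
(* Nonnegativity lets dead chips, whose potential is already maximal, satisfy the same bound as
   alive ones. *)
have K0 : 0 <= K.
  have D0 : 0 <= D.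
    by apply: le_trans dD; rewrite mulr_ge0//; case/andP: delta01.
  have c0 := gauss_coef_gt0 R.
  apply: mulr_ge0; first by apply: mulr_ge0; lra.
  rewrite subr_ge0 lef_pV2 ?posrE ?sqrtr_gt0; try lra.
  by apply: ler_wsqrtr; lra.
have step i : potential delta T (position ((p, z) :: h) i)
    (time T ((p, z) :: h) - tau) <=
    potential delta T (position h i) (time T h - tau)
    - weight delta T tau h i * z i + K.
  rewrite time_cons /= /weight; case: ifP => [dead|/negbT].
    by rewrite (potential_dead _ dead) mul0r subr0 ler_wpDr// potential_le1.
  rewrite -ltNge => alive; rewrite mulNr opprK /K tE.
  exact: potential_step.
rewrite /total_potential; apply: le_trans (ler_sum _ (fun i _ => step i)) _.
rewrite 2!big_split/= sumrN sumr_const card_ord -[K *+ N]mulr_natl.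
by rewrite lerD2r gerBl.
Qed.

(** The errors of successive rounds telescope. As tau <= T, every quantity -2(t + 1 - tau) is at
    most 4T, so one [D] serves all rounds. *)
Lemma total_potential_play (player : player_strategy R N)
    (adversary : adversary_strategy R N) D k :
  1 <= tau <= T%:R -> delta * Num.sqrt (4 * T%:R) <= D -> (k <= T)%N ->
  (forall k, (k < T)%N -> prescribed delta T tau
    (play player adversary k) (player (play player adversary k))) ->
  admissible_adversary delta T adversary ->
  total_potential (play player adversary k) <= total_potential [::] + N%:R *
    (3 * (2 / Num.sqrt pi) * (66 + 3 * D) *
      ((Num.sqrt (2 * (T%:R - k%:R + tau)))^-1 -
       (Num.sqrt (2 * (T%:R + tau)))^-1)).
Proof.
move=> /andP[tau1 tauT] dD + pp adm; elim: k => [_|k IH kT].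
  by rewrite subr0 subrr !mulr0 addr0.
have szE m : size (play player adversary m) = m by elim: m => //= m ->.
have kT' : k%:R + 1 <= T%:R :> R by rewrite natr1 ler_nat.
have k0 : 0 <= k%:R :> R by [].
have timeE : time T (play player adversary k) = - T%:R + k%:R.
  by rewrite /time szE.
apply: le_trans (total_potential_step (D := D) _ _ (pp _ kT) _) _.
- rewrite timeE; lra.
- apply: le_trans dD; rewrite ler_wpM2l//; first by case/andP: delta01.
  by apply: ler_wsqrtr; rewrite timeE; lra.
- by apply: adm; [rewrite szE|have [] := pp _ kT].
apply: le_trans (lerD (IH (ltnW kT)) (lexx _)) _.
rewrite timeE (_ : k.+1%:R = k%:R + 1); last by rewrite natr1.
rewrite (_ : - 2 * (- T%:R + k%:R + 1 - tau) = 2 * (T%:R - (k%:R + 1) + tau));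
  last by ring.
rewrite (_ : - 2 * (- T%:R + k%:R - tau) = 2 * (T%:R - k%:R + tau)); last by ring.
by rewrite le_eqVlt; apply/orP; left; apply/eqP; ring.
Qed.

Lemma final_loss_le (player : player_strategy R N)
    (adversary : adversary_strategy R N) :
  final_loss delta T player adversary <=
    N%:R^-1 * total_potential (play player adversary T).
Proof.
rewrite ler_wpM2l ?invr_ge0//; apply: ler_sum => i _; rewrite /loss.
have [dead|_] := leP (position _ i); last exact: potential_ge0.
by rewrite potential_dead.
Qed.

(** Without the shift the initial argument would be sqrt(gamma). The shift multiplies it by sqrt(T /
    (T + tau)), and the Lipschitz bound controls the resulting loss. *)
Lemma initial_potential_le gamma : (0 < T)%N -> 0 <= tau ->
  gamma = delta ^+ 2 * T%:R / 2 ->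
  total_potential [::] <= N%:R * (gauss_tail (Num.sqrt gamma)
    + 2 / Num.sqrt pi * Num.sqrt gamma * (tau / T%:R)).
Proof.
move=> T0 tau0 gammaE.
have T0' : 0 < T%:R :> R by rewrite ltr0n.
have d0 : 0 <= delta by case/andP: delta01.
have gamma0 : 0 <= gamma by rewrite gammaE divr_ge0// mulr_ge0// sqr_ge0.
rewrite /total_potential /=.
rewrite (eq_bigr
  (fun=> potential delta T 0 (time T ([::] : history R N) - tau)))//.
rewrite sumr_const card_ord -[leLHS]mulr_natl ler_wpM2l//.
apply: le_trans (potential_le_gauss_tail _ _ _ _) _.
rewrite add0r /time /= addr0.
rewrite (_ : - 2 * (- T%:R - tau) = 2 * (T%:R + tau)); last by ring.
set y := delta * T%:R / _; set g := Num.sqrt gamma.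
have g0 : 0 <= g by exact: sqrtr_ge0.
have y0 : 0 <= y by rewrite divr_ge0// mulr_ge0.
have S0 : 0 < T%:R + tau by rewrite ltr_wpDr.
have yE : y ^+ 2 = gamma * (T%:R / (T%:R + tau)).
  rewrite /y exprMn exprVn sqr_sqrtr; last by rewrite mulr_ge0// ltW.
  by rewrite gammaE; field; rewrite gt_eqF.
have r1 : T%:R / (T%:R + tau) <= 1 by rewrite ler_pdivrMr// mul1r lerDl.
have r0 : 0 <= T%:R / (T%:R + tau) by rewrite divr_ge0// ltW.
have gE : g ^+ 2 = gamma by rewrite sqr_sqrtr.
have yg : y <= g by rewrite -(@ler_pXn2r _ 2)// yE gE ler_piMr.
(* A ratio in [0, 1] is at most its own square root. *)
have gy : g * (T%:R / (T%:R + tau)) <= y.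
  rewrite -(@ler_pXn2r _ 2)// ?nnegrE; last exact: mulr_ge0.
  rewrite exprMn yE gE ler_wpM2l//.
  by rewrite expr2 ler_piMl.
apply: le_trans (gauss_tail_lipschitz yg) _.
rewrite lerD2l -[leRHS]mulrA ler_wpM2l ?(ltW (gauss_coef_gt0 R))//.
apply: (@le_trans _ _ (g * (tau / (T%:R + tau)))).
  rewrite (_ : tau / (T%:R + tau) = 1 - T%:R / (T%:R + tau)); first lra.
  by field; rewrite gt_eqF.
by rewrite ler_wpM2l// ler_wpM2l// lef_pV2 ?posrE// lerDl.
Qed.

End Game.

(** * Assembling the final loss bound *)

Theorem theorem8 (R : realType) (gamma theta : R) :
  0 <= gamma -> 0 < theta -> theta < 2 / 3 ->
  exists (C : R) (T0 : nat),
    forall (T N : nat) (delta : R)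
           (player : player_strategy R N)
           (adversary : adversary_strategy R N),
      (T0 <= T)%N -> (0 < N)%N ->
      0 <= delta <= 1 -> gamma = delta ^+ 2 * T%:R / 2 ->
      (forall k : nat, (k < T)%N ->
         prescribed delta T (T%:R `^ theta)
           (play player adversary k) (player (play player adversary k))) ->
      admissible_adversary delta T adversary ->
      final_loss delta T player adversary <=
        gauss_tail (Num.sqrt gamma) + C * T%:R `^ (- theta / 2).
Proof.
move=> gamma0 theta0 theta1.
(* Since delta^2 T = 2 gamma, the square of delta sqrt(4T) is exactly 8 gamma. *)
set D := Num.sqrt (8 * gamma); set c : R := 2 / Num.sqrt pi.
(* The first summand pays for the initial time shift, the second for the telescoped errors. The
   threshold T >= 1 gives 1 <= tau <= T. *)
exists (c * Num.sqrt gamma + 3 * c * (66 + 3 * D)), 1%N.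
move=> T N delta player adversary T1 N1 delta01 gammaE pp adm.
have c0 : 0 < c := gauss_coef_gt0 R.
have D0 : 0 <= D by exact: sqrtr_ge0.
have T1' : 1 <= T%:R :> R by rewrite ler1n.
have T0 : 0 < T%:R :> R by lra.
have N0 : N%:R != 0 :> R by rewrite pnatr_eq0 -lt0n.
set tau := T%:R `^ theta in pp *.
have tau1 : 1 <= tau by rewrite -(powRr0 T%:R) ler_powR// ltW.
have tauT : tau <= T%:R by rewrite -[leRHS]powRr1 ?ler0n// ler_powR//; lra.
have dD : delta * Num.sqrt (4 * T%:R) <= D.
  rewrite -(@ler_pXn2r _ 2)// ?nnegrE; last first.
    by rewrite mulr_ge0//; case/andP: delta01.
  rewrite exprMn !sqr_sqrtr ?mulr_ge0// gammaE.
  by rewrite le_eqVlt; apply/orP; left; apply/eqP; field.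
have tau1T : 1 <= tau <= T%:R by rewrite tau1.
have tau0 : 0 <= tau by lra.
(* The exponents compare as theta - 1 <= - theta / 2, that is theta <= 2/3. *)
have Tle : tau / T%:R <= T%:R `^ (- theta / 2).
  rewrite -powR_inv1 ?ler0n// -powRD; last by rewrite (gt_eqF T0) implybT.
  by rewrite ler_powR//; lra.
have tauE : (Num.sqrt tau)^-1 = T%:R `^ (- theta / 2).
  by rewrite -powR12_sqrt// -powRN -powRrM; congr (_ `^ _); field.
have := total_potential_play delta01 tau1T dD (leqnn T) pp adm.
rewrite subrr add0r => H.
apply: le_trans (final_loss_le T delta tau player adversary) _.
rewrite -(@ler_pM2l _ N%:R) ?ltr0n// mulrA divff// mul1r.
apply: le_trans H _.
have I0 := initial_potential_le N delta01 T1 tau0 gammaE.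
apply: le_trans (lerD I0 (lexx _)) _.
rewrite -mulrDr ler_wpM2l// -addrA lerD2l [leRHS]mulrDl; apply: lerD.
  by rewrite ler_wpM2l// mulr_ge0// ltW.
rewrite ler_wpM2l//; first by rewrite !mulr_ge0 ?(ltW c0)//; lra.
(* Only the end of the telescoped sum matters: its initial term is dropped, and (2 tau)^(-1/2) <=
   tau^(-1/2). *)
apply: (@le_trans _ _ (Num.sqrt (2 * tau))^-1).
  by rewrite gerBl invr_ge0.
rewrite -tauE lef_pV2 ?posrE ?sqrtr_gt0; try lra.
by apply: ler_wsqrtr; lra.
Qed.
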